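(* Let $(\Omega,\mathcal F)$ be a measurable space, $n\ge 1$, and let $P_1,\dots,P_n,Q_1,\dots,Q_n$ be probability measures on $(\Omega,\mathcal F)$. Put $\vec P:=\bigotimes_{i=1}^nP_i$, $\vec Q:=\bigotimes_{i=1}^nQ_i$, $\bar P:=\frac1n\sum_{i=1}^nP_i$, $\bar Q:=\frac1n\sum_{i=1}^nQ_i$, $\bar{\vec P}:=\bar P^{\otimes n}$, $\bar{\vec Q}:=\bar Q^{\otimes n}$. Then \[ \mathrm{TV}(\vec P,\vec Q)\ge c\,\mathrm{TV}(\bar{\vec P},\bar{\vec Q}), \] where $c>0.1489$ is an absolute constant. Moreover, if $\Omega$ is finite, then $\mathrm{TV}(\bar{\vec P},\bar{\vec Q})=\mathrm{TV}(\mathrm{Mult}(n,\bar P),\mathrm{Mult}(n,\bar Q))$.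
   Context: $\mathrm{TV}(\mu,\nu)=\sup_{E}|\mu(E)-\nu(E)|$ over measurable sets $E$. $\mathrm{Mult}(n,P)$ denotes the multinomial distribution of the vector of counts of $n$ i.i.d. draws from $P$ on the finite set $\Omega$. *)

(* Defs.v *)
From HB Require Import structures.
From mathcomp Require Import all_boot all_order all_algebra.
From mathcomp Require Import all_classical all_reals all_analysis.
Set Implicit Arguments. Unset Strict Implicit. Unset Printing Implicit Defensive.
Import Order.TTheory GRing.Theory Num.Theory.
Local Open Scope classical_set_scope.
Local Open Scope ring_scope.

Definition TV_on (U : Type) (R : realType) (M : set (set U))
  (mu nu : set U -> \bar R) : \bar R :=
  ereal_sup [set (`|mu E - nu E|)%E | E in M].

Definition TV d (U : measurableType d) (R : realType)
  (mu nu : set U -> \bar R) : \bar R := TV_on measurable mu nu.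

(* n-fold product measure  P_0 (x) P_1 (x) ... (x) P_{n-1}  on n.-tuple T
   (equipped with the product sigma-algebra generated by the coordinates),
   built by iterating the binary product measure of mathcomp-analysis:
   P_0 (x) (P_1 (x) ... ) pushed forward along (x, t) |-> x :: t.
   For n = 0 it is the Dirac mass at the empty tuple. *)
Fixpoint prod_meas d (T : measurableType d) (R : realType) (n : nat) :
    ('I_n -> set T -> \bar R) -> set (n.-tuple T) -> \bar R :=
  match n with
  | 0 => fun _ A => ((\1_A [tuple] : R)%:E)
  | n'.+1 => fun P =>
      pushforward
        (product_measure1 (P ord0) (@prod_meas d T R n' (fun i => P (lift ord0 i))))
        (fun p : T * n'.-tuple T => cons_tuple p.1 p.2)
  end.

Definition pow_meas d (T : measurableType d) (R : realType) (n : nat)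
  (P : set T -> \bar R) : set (n.-tuple T) -> \bar R :=
  @prod_meas d T R n (fun _ => P).

Definition avg_meas d (T : measurableType d) (R : realType) (n : nat)
  (P : 'I_n -> set T -> \bar R) : set T -> \bar R :=
  fun A => ((n%:R)^-1%:E * \sum_(i < n) P i A)%E.

#[short(type="finMeasurableType")]
HB.structure Definition FinMeasurable d := {T of Measurable d T & Finite T}.

Definition counts (T : finType) (n : nat) (s : n.-tuple T) : {ffun T -> nat} :=
  [ffun x => count_mem x s].

Definition mult d (T : finMeasurableType d) (R : realType) (n : nat)
  (P : set T -> \bar R) : set {ffun T -> nat} -> \bar R :=
  fun E => (\sum_(s : n.-tuple T)
             (\1_E (counts s) : R) * \prod_(i < n) fine (P [set tnth s i]))%:E.

(* Main.v *)
Require Import Defs.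
From HB Require Import structures.
From mathcomp Require Import all_boot all_order all_algebra all_fingroup.
From mathcomp Require Import all_classical all_reals all_analysis.
From mathcomp Require Import ring lra.
Set Implicit Arguments. Unset Strict Implicit. Unset Printing Implicit Defensive.
Import Order.TTheory GRing.Theory Num.Theory.
Local Open Scope ring_scope.

(** Expanding the product, the n-th power of the mean of the [P_i] is the mean,
   over all maps g : [n] -> [n], of the products of the [P_(g j)].  Split the
   positions j into layers, j being in layer k when g takes the value g j
   exactly k times before j.  On a layer g is injective, so changing P into Q
   on layer k costs at most the distance between a marginal of (x)P_i and the
   same marginal of (x)Q_i; averaging over permutations, this marginal may be
   taken on a uniformly random set S with as many elements as the layer.

   If [n] contains m disjoint copies of S, the sign tests of the m blocks can
   be combined by a Riesz product into a single test for the whole product,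
   which shows that a random block of that size carries at most
   O(m^(-1/2)) times the full distance.  Layer k contains on average at most
   a fraction O(5^(-k)) of the positions, with the explicit constant given by
   the exponential moment bound E 5^(Binomial(n, 1/n)) <= e^4, so the costs of
   the layers k >= 5 sum up to less than 1.5 times the full distance, and
   those of the first five layers to at most 5 times.  As 6.5 < 1/0.149 this
   is enough.

   All this takes place over a finite alphabet.  In general an event of the
   product space is approximated by a cylinder over a finite measurable
   partition. *)

(** * Finite product distributions *)

Section FiniteProducts.
Variables (R : realType) (K F : finType).
Implicit Types (A B : {set K}) (p q r s : K -> F -> R) (x y : {ffun K -> F})
  (G H : {ffun K -> F} -> R).

Definition depends_on A G :=
  forall x y, (forall i, i \in A -> x i = y i) -> G x = G y.

Definition prodw r x := \prod_i r i (x i).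

Definition expect r G := \sum_x G x * prodw r x.

(** For probability weights this is twice the total variation distance of the two product
    distributions. *)
Definition dist r s := \sum_x `|prodw r x - prodw s x|.

Definition is_prob r :=
  (forall i f, 0 <= r i f) /\ (forall i, \sum_f r i f = 1).

Definition hybrid A p q i := if i \in A then q i else p i.

Definition mix A x y : {ffun K -> F} := [ffun i => if i \in A then x i else y i].

(* Exchanging the coordinates outside [A] of two points is an involution. *)
Lemma sum_indep A G H : depends_on A G -> depends_on (~: A) H ->
  (\sum_x G x) * (\sum_x H x) = #|{ffun K -> F}|%:R * \sum_x G x * H x.
Proof.
move=> dG dH.
rewrite big_distrlr /= pair_bigA /=.
have -> : #|{ffun K -> F}|%:R * (\sum_x G x * H x)
   = \sum_(u : {ffun K -> F} * {ffun K -> F}) G u.1 * H u.1.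
  rewrite -(pair_bigA _ (fun x _ => G x * H x)) /= mulr_sumr.
  by apply: eq_bigr => x _; rewrite sumr_const mulr_natl.
pose sw u := (mix A u.1 u.2, mix A u.2 u.1).
have swK : involutive sw.
  by case=> x y; rewrite /sw /=; congr pair; apply/ffunP => i; rewrite !ffunE;
    case: (i \in A).
rewrite [RHS](reindex_inj (inv_inj swK)) /=; apply: eq_bigr => -[x y] _ /=.
congr (_ * _).
  by apply: dG => i iA; rewrite ffunE iA.
by apply: dH => i; rewrite inE => /negPf iA; rewrite ffunE iA.
Qed.

Lemma prodw_split A r x :
  prodw r x = (\prod_(i in A) r i (x i)) * \prod_(i in ~: A) r i (x i).
Proof.
rewrite /prodw (bigID (mem A)) /=; congr (_ * _).
by apply: eq_bigl => i; rewrite inE.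
Qed.

Lemma depends_on_prod A r : depends_on A (fun x => \prod_(i in A) r i (x i)).
Proof. by move=> x y exy; apply: eq_bigr => i /exy ->. Qed.

Lemma depends_onM A G H : depends_on A G -> depends_on A H ->
  depends_on A (fun x => G x * H x).
Proof. by move=> dG dH x y e; rewrite (dG x y e) (dH x y e). Qed.

Lemma depends_onS A B G : A \subset B -> depends_on A G -> depends_on B G.
Proof. by move=> /fintype.subsetP sAB dG x y e; apply: dG => i /sAB /e. Qed.

Lemma sum_prodw r : (forall i, \sum_f r i f = 1) -> \sum_x prodw r x = 1.
Proof.
by move=> r1; rewrite /prodw -(bigA_distr_bigA r) big1.
Qed.

(** Each coordinate in [A] contributes a factor 1 and every other one a factor [#|F|], whatever the
    weights. *)
Lemma sum_prod_restr A r s : (forall i, \sum_f r i f = 1) ->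
  (forall i, \sum_f s i f = 1) ->
  \sum_(x : {ffun K -> F}) \prod_(i in A) r i (x i) =
  \sum_(x : {ffun K -> F}) \prod_(i in A) s i (x i).
Proof.
move=> r1 s1.
have E t : (forall i, \sum_f t i f = 1) -> \sum_(x : {ffun K -> F}) \prod_(i in A) t i (x i)
    = \prod_(i : K) (if i \in A then 1 else #|F|%:R) :> R.
  move=> t1.
  transitivity (\sum_(x : {ffun K -> F})
      \prod_i (if i \in A then t i (x i) else 1)).
    by apply: eq_bigr => x _; rewrite big_mkcond.
  rewrite -(bigA_distr_bigA (fun i f => if i \in A then t i f else 1)).
  apply: eq_bigr => i _; case: ifP => _; first exact: t1.
  by rewrite sumr_const.
by rewrite !E.
Qed.

(** Multiplied by the number of points, the expectation splits by [sum_indep] into a factor over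
    [A], where the weights agree, and a factor over the complement, equal for all probability
    weights. *)
Lemma expect_local A r s G : is_prob r -> is_prob s ->
  (forall i, i \in A -> r i = s i) -> depends_on A G ->
  expect r G = expect s G.
Proof.
move=> [_ r1] [_ s1] rs dG.
(* The number of points is cancelled below, so an empty space is treated apart. *)
case: (boolP (#|{ffun K -> F}| == 0)%N) => [/eqP c0|c0].
  by rewrite /expect; apply: eq_bigr => x _; have := card0_eq c0 x.
have cR : #|{ffun K -> F}|%:R != 0 :> R by rewrite pnatr_eq0.
apply: (mulfI cR).
have E t : #|{ffun K -> F}|%:R * expect t G =
   (\sum_x G x * \prod_(i in A) t i (x i)) *
   \sum_(x : {ffun K -> F}) \prod_(i in ~: A) t i (x i).
  rewrite (@sum_indep A) //.
  - by congr (_ * _); apply: eq_bigr => x _; rewrite (prodw_split A) mulrA.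
  - by apply: depends_onM => //; exact: depends_on_prod.
  - exact: depends_on_prod.
rewrite !E (sum_prod_restr _ r1 s1); congr (_ * _).
apply: eq_bigr => x _; congr (_ * _).
by apply: eq_bigr => i /rs ->.
Qed.

(** With N the number of points, four uses of [sum_indep] give N E[GH] = a b, N E[G] = a b1, N E[H]
    = a1 b and N = a1 b1; the claim follows after multiplication by N^2. *)
Lemma expectM A r G H : is_prob r -> depends_on A G -> depends_on (~: A) H ->
  expect r (fun x => G x * H x) = expect r G * expect r H.
Proof.
move=> [_ r1] dG dH.
case: (boolP (#|{ffun K -> F}| == 0)%N) => [/eqP c0|c0].
  have := sum_prodw r1; rewrite big1 => [/esym/eqP|x _]; last first.
    by have := card0_eq c0 x.
  by rewrite oner_eq0.
have cR : #|{ffun K -> F}|%:R != 0 :> R by rewrite pnatr_eq0.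
set a := \sum_x G x * \prod_(i in A) r i (x i).
set b := \sum_x H x * \prod_(i in ~: A) r i (x i).
set a1 := \sum_(x : {ffun K -> F}) \prod_(i in A) r i (x i).
set b1 := \sum_(x : {ffun K -> F}) \prod_(i in ~: A) r i (x i).
have dA : depends_on A (fun x => \prod_(i in A) r i (x i)).
  exact: depends_on_prod.
have dB : depends_on (~: A) (fun x => \prod_(i in ~: A) r i (x i)).
  exact: depends_on_prod.
have E1 : #|{ffun K -> F}|%:R * expect r (fun x => G x * H x) = a * b.
  rewrite (@sum_indep A); [|exact: depends_onM|exact: depends_onM].
  by congr (_ * _); apply: eq_bigr => x _; rewrite (prodw_split A); ring.
have E2 : #|{ffun K -> F}|%:R * expect r G = a * b1.
  rewrite (@sum_indep A); [|exact: depends_onM|exact: dB].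
  by congr (_ * _); apply: eq_bigr => x _; rewrite (prodw_split A); ring.
have E3 : #|{ffun K -> F}|%:R * expect r H = a1 * b.
  rewrite (@sum_indep A); [|exact: dA|exact: depends_onM].
  by congr (_ * _); apply: eq_bigr => x _; rewrite (prodw_split A); ring.
have E4 : #|{ffun K -> F}|%:R = a1 * b1.
  rewrite (@sum_indep A) //.
  under eq_bigr do rewrite -prodw_split.
  by rewrite (sum_prodw r1) mulr1.
apply: (mulfI cR); rewrite E1; apply: (mulfI cR).
transitivity ((#|{ffun K -> F}|%:R * expect r G) *
  (#|{ffun K -> F}|%:R * expect r H)).
  by rewrite E2 E3 {1}E4; ring.
by ring.
Qed.

Lemma expectD r G H : expect r (fun x => G x + H x) = expect r G + expect r H.
Proof.
by rewrite /expect -big_split; apply: eq_bigr => x _; rewrite mulrDl.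
Qed.

Lemma expectZ r (c : R) G : expect r (fun x => c * G x) = c * expect r G.
Proof. by rewrite /expect mulr_sumr; apply: eq_bigr => x _; rewrite mulrA. Qed.

Lemma expect_cst r (c : R) : is_prob r -> expect r (fun=> c) = c.
Proof. by case=> _ r1; rewrite /expect -mulr_sumr sum_prodw// mulr1. Qed.

Lemma prodw_ge0 r x : is_prob r -> 0 <= prodw r x.
Proof. by case=> r0 _; apply: prodr_ge0 => i _. Qed.

Lemma expect_bound r G (M : R) : is_prob r -> (forall x, `|G x| <= M) ->
  `|expect r G| <= M.
Proof.
move=> pr GM; rewrite -[leRHS](expect_cst M pr).
apply: (le_trans (ler_norm_sum _ _ _)); apply: ler_sum => x _.
by rewrite normrM (ger0_norm (prodw_ge0 x pr)) ler_wpM2r// prodw_ge0.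
Qed.

Lemma expect_dist r s G (M : R) : (forall x, `|G x| <= M) ->
  expect r G - expect s G <= M * dist r s.
Proof.
move=> GM; rewrite /expect /dist -sumrB mulr_sumr; apply: ler_sum => x _.
rewrite -mulrBr (le_trans (ler_norm _))// normrM.
by rewrite ler_wpM2r.
Qed.

Lemma dist_ge0 r s : 0 <= dist r s.
Proof. exact: sumr_ge0. Qed.

Lemma dist_triangle s r t : dist r t <= dist r s + dist s t.
Proof.
rewrite /dist -big_split; apply: ler_sum => x _.
have -> : prodw r x - prodw t x =
  (prodw r x - prodw s x) + (prodw s x - prodw t x) by ring.
exact: ler_normD.
Qed.

Lemma dist_le2 r s : is_prob r -> is_prob s -> dist r s <= 2.
Proof.
move=> pr ps; have -> : 2 = \sum_x (prodw r x + prodw s x).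
  by rewrite big_split /= !sum_prodw; [|case: ps|case: pr].
apply: ler_sum => x _; apply: (le_trans (ler_normB _ _)).
by rewrite !ger0_norm// prodw_ge0.
Qed.

(** The optimal test for telling the marginals on [A] apart. *)
Definition sgn_test A r s x : R :=
  Num.sg (\prod_(i in A) r i (x i) - \prod_(i in A) s i (x i)).

Lemma sgn_test_dep A r s : depends_on A (sgn_test A r s).
Proof.
move=> x y e; rewrite /sgn_test.
by rewrite (@depends_on_prod A r x y e) (@depends_on_prod A s x y e).
Qed.

Lemma sgn_test_bound A r s x : `|sgn_test A r s x| <= 1.
Proof. by rewrite /sgn_test normr_sg; case: eqP. Qed.

(** Outside [A] both weights share a nonnegative factor, so multiplying their difference by its sign
    on [A] gives the absolute value at every point. *)
Lemma expect_sgn_test A r s : is_prob r ->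
  (forall i, i \notin A -> r i = s i) ->
  expect r (sgn_test A r s) - expect s (sgn_test A r s) = dist r s.
Proof.
move=> pr rs; rewrite /expect -sumrB; apply: eq_bigr => x _.
rewrite -mulrBr !(prodw_split A).
have -> : \prod_(i in ~: A) s i (x i) = \prod_(i in ~: A) r i (x i).
  by apply: eq_bigr => i; rewrite inE => /rs ->.
rewrite -mulrBl mulrA normrM -normrEsg; congr (_ * _).
by rewrite ger0_norm// prodr_ge0// => i _; case: pr.
Qed.

(** The sign test attaining the left side looks only at [A], so its expectations are the same under
    [s] and [s'], which no test bounded by 1 separates by more than their distance. *)
Lemma dist_local A r r' s s' : is_prob r -> is_prob r' -> is_prob s ->
  is_prob s' -> (forall i, i \notin A -> r i = r' i) ->
  (forall i, i \in A -> r i = s i) -> (forall i, i \in A -> r' i = s' i) ->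
  dist r r' <= dist s s'.
Proof.
move=> pr pr' ps ps' e e1 e2; rewrite -(expect_sgn_test pr e).
have dA := @sgn_test_dep A r r'.
rewrite (expect_local pr ps e1 dA) (expect_local pr' ps' e2 dA).
by rewrite -[leRHS]mul1r; apply: expect_dist => x; exact: sgn_test_bound.
Qed.

Lemma is_prob_hybrid A p q : is_prob p -> is_prob q -> is_prob (hybrid A p q).
Proof.
by case=> p0 p1 [q0 q1]; split=> i *; rewrite /hybrid; case: ifP.
Qed.

Definition hdist p q A := dist p (hybrid A p q).

Lemma hdist_le p q A : is_prob p -> is_prob q -> hdist p q A <= dist p q.
Proof.
move=> pp pq; apply: (@dist_local A) => //; first exact: is_prob_hybrid.
  by move=> i /negPf iA; rewrite /hybrid iA.
by move=> i iA; rewrite /hybrid iA.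
Qed.

Lemma hybrid_step p q A B : is_prob p -> is_prob q -> [disjoint A & B] ->
  dist (hybrid A p q) (hybrid (A :|: B) p q) <= hdist p q B.
Proof.
move=> pp pq dAB; apply: (@dist_local B);
  rewrite /hybrid; try (by apply: is_prob_hybrid); try by [].
- by move=> i /negPf iB; rewrite inE iB orbF.
- by move=> i iB; rewrite (disjointFl dAB iB).
- by move=> i iB; rewrite inE iB orbT.
Qed.

(** The passage from [p] to [q] is made one layer at a time; by disjointness each change is a
    [hybrid_step]. *)
Lemma dist_layers p q (L : nat -> {set K}) m : is_prob p -> is_prob q ->
  (forall j k, (j < k)%N -> [disjoint L j & L k]) ->
  dist p (hybrid (\bigcup_(k < m) L k) p q) <= \sum_(k < m) hdist p q (L k).
Proof.
move=> pp pq dL; elim: m => [|m IH].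
  rewrite !big_ord0 /hybrid (_ : (fun i => _) = p); last first.
    by apply/funext => i; rewrite inE.
  by rewrite /dist big1// => x _; rewrite subrr normr0.
rewrite !big_ord_recr /=.
apply: (le_trans (dist_triangle (hybrid (\bigcup_(k < m) L k) p q) _ _)).
apply: lerD => //; apply: hybrid_step => //.
by rewrite disjoint_sym bigcup_disjoint// => k _; rewrite disjoint_sym dL.
Qed.

Lemma dist_perm p q (t : {perm K}) : dist (p \o t) (q \o t) = dist p q.
Proof.
pose h (x : {ffun K -> F}) : {ffun K -> F} := [ffun i => x (t i)].
have hinj : injective h.
  move=> x y /ffunP e; apply/ffunP => i.
  by have := e (t^-1%g i); rewrite !ffunE permKV.
rewrite /dist [LHS](reindex_inj hinj); apply: eq_bigr => x _.
rewrite /prodw [X in _ = `|X - _|](reindex_inj (@perm_inj _ t)).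
rewrite [X in _ = `|_ - X|](reindex_inj (@perm_inj _ t)) /=.
by congr (`|_ - _|); apply: eq_bigr => i _; rewrite ffunE.
Qed.

Lemma hdist_perm p q (t : {perm K}) A :
  hdist p q (t @: A) = hdist (p \o t) (q \o t) A.
Proof.
rewrite /hdist -(dist_perm _ _ t); congr dist; apply/funext => i.
by rewrite /hybrid /= mem_imset//; exact: perm_inj.
Qed.

Lemma is_prob_comp (g : K -> K) p : is_prob p -> is_prob (p \o g).
Proof. by case=> p0 p1; split=> i *; [exact: p0|exact: p1]. Qed.

End FiniteProducts.

(** * Combining tests on disjoint blocks *)

Section RieszProducts.
Variable R : realType.
Implicit Types w : nat -> R.

(* Real and imaginary part of [\prod_(j < k) (1 + 'i * w j)]. *)
Fixpoint riesz (w : nat -> R) k : R * R :=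
  if k is k'.+1 then
    ((riesz w k').1 - w k' * (riesz w k').2, (riesz w k').2 + w k' * (riesz w k').1)
  else (1, 0).

Lemma riesz_opp w k : riesz (fun j => - w j) k = ((riesz w k).1, - (riesz w k).2).
Proof. by elim: k => [|k /= ->] /=; rewrite ?oppr0//; congr pair; ring. Qed.

(** The squared modulus is multiplicative, and that of one factor is 1 + w^2. *)
Lemma riesz_norm w t k : (forall j, w j ^+ 2 <= t) ->
  (riesz w k).1 ^+ 2 + (riesz w k).2 ^+ 2 <= (1 + t) ^+ k.
Proof.
move=> wt; elim: k => [|k IH] /=; first by rewrite expr0; lra.
set c := (riesz w k).1 in IH *; set s := (riesz w k).2 in IH *.
have -> : (c - w k * s) ^+ 2 + (s + w k * c) ^+ 2 = (1 + w k ^+ 2) * (c ^+ 2 + s ^+ 2).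
  by ring.
rewrite [leRHS]exprS; apply: ler_pM => //.
- by rewrite addr_ge0// sqr_ge0.
- by rewrite addr_ge0// sqr_ge0.
- by rewrite lerD2l.
Qed.

Lemma riesz_im_ge w m : (forall j, 0 <= w j) -> \sum_(j < m) w j <= 1 ->
  (\sum_(j < m) w j) / 2 <= (riesz w m).2.
Proof.
move=> w0 wm.
(* With S the partial sum, the induction also keeps the real part between 1 - S^2/2 and 1. As S <= 1
   it is at least 1/2, so each factor adds at least half its weight to the imaginary part. *)
suff [] : [/\ 0 <= (riesz w m).2, (riesz w m).2 <= \sum_(j < m) w j,
  1 - (\sum_(j < m) w j) ^+ 2 / 2 <= (riesz w m).1, (riesz w m).1 <= 1 &
  (\sum_(j < m) w j) / 2 <= (riesz w m).2] by [].
elim: m wm => [|m IH]; rewrite ?big_ord0 ?big_ord_recr /= => wm.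
  by split; lra.
have S0 : 0 <= \sum_(j < m) w j by exact: sumr_ge0.
have := w0 m => wm0.
have [] := IH; first by lra.
set S := \sum_(j < m) w j in wm S0 *; set c := (riesz w m).1; set s := (riesz w m).2.
set z := w m in wm wm0 *; move=> s0 sS cS c1 Ss.
have S2 : S ^+ 2 <= 1 by rewrite expr_le1//; lra.
have c2 : 1 / 2 <= c by lra.
have zc1 : z * c <= z by rewrite ler_piMr.
have zc2 : z / 2 <= z * c by rewrite ler_wpM2l//; lra.
have zs0 : 0 <= z * s by rewrite mulr_ge0.
have zsS : z * s <= z * S by rewrite ler_wpM2l.
have z2 : 0 <= z ^+ 2 by rewrite sqr_ge0.
have -> : (S + z) ^+ 2 = S ^+ 2 + 2 * (z * S) + z ^+ 2 by ring.
by split; lra.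
Qed.

(** The bound is the square of 5/3, the bound needed for the Riesz test. It comes from e^(1/32) <=
    1/(1 - 1/32) by five squarings, rounding up each time. *)
Lemma expR1_le : expR 1 <= 25 / 9 :> R.
Proof.
have h0 : expR 32^-1 <= 10323 / 10000 :> R.
  have := @expR_ge1Dx R (- 32^-1); rewrite expRN => h.
  have e0 := expR_gt0 (32^-1 : R).
  have : expR 32^-1 * (1 - 32^-1) <= 1 :> R.
    by rewrite -[leRHS](mulfV (lt0r_neq0 e0)) ler_pM2l.
  by lra.
have st (x a b : R) : expR x <= a -> a ^+ 2 <= b -> expR (x * 2) <= b.
  move=> xa; apply: le_trans; rewrite mulr_natr mulr2n expRD -expr2.
  by rewrite lerXn2r ?nnegrE ?expR_ge0// (le_trans (expR_ge0 x)).
have -> : 1 = 32^-1 * 2 * 2 * 2 * 2 * 2 :> R by lra.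
apply: (st _ (16657 / 10000)); last by lra.
apply: (st _ (12904 / 10000)); last by lra.
apply: (st _ (11358 / 10000)); last by lra.
apply: (st _ (10657 / 10000)); last by lra.
by apply: (st _ (10323 / 10000)); [|lra].
Qed.

Lemma exprD1_le (t : R) m : 0 <= t -> (1 + t) ^+ m <= expR (t * m%:R).
Proof.
move=> t0; rewrite [t * _]mulrC expRM_natl; apply: lerXn2r; rewrite ?nnegrE.
- by rewrite addr_ge0.
- exact: expR_ge0.
- exact: expR_ge1Dx.
Qed.

Variables (K F : finType).
Implicit Types p q : K -> F -> R.

Lemma riesz_depends (B : nat -> {set K}) (u : nat -> {ffun K -> F} -> R) k :
  (forall j, depends_on (B j) (u j)) ->
  forall x y : {ffun K -> F}, (forall i, i \in \bigcup_(j < k) B j -> x i = y i) ->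
  riesz (u ^~ x) k = riesz (u ^~ y) k.
Proof.
move=> du x y; elim: k => //= k IH; rewrite big_ord_recr /= => exy.
rewrite (du k x y); last by move=> i ik; rewrite exy// inE ik orbT.
by rewrite IH// => i ik; rewrite exy// inE ik.
Qed.

(** Tests on disjoint blocks are independent, so the expectation of the complex product is the
    product of the expectations. *)
Lemma expect_riesz (r : K -> F -> R) (B : nat -> {set K})
    (u : nat -> {ffun K -> F} -> R) m :
  is_prob r -> (forall j, depends_on (B j) (u j)) ->
  (forall j k, (j < k < m)%N -> [disjoint B j & B k]) ->
  (expect r (fun x => (riesz (u ^~ x) m).1),
   expect r (fun x => (riesz (u ^~ x) m).2)) =
  riesz (fun j => expect r (u j)) m.
Proof.
move=> pr du; elim: m => [|m IH] dB /=; first by rewrite !expect_cst.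
rewrite -IH /=; last by move=> j k /andP[jk km]; rewrite dB// jk ltnW.
have dR g : depends_on (\bigcup_(j < m) B j) (fun x => g (riesz (u ^~ x) m) : R).
  by move=> x y e; rewrite (@riesz_depends B u m du x y e).
have dm : depends_on (~: \bigcup_(j < m) B j) (u m).
  apply: depends_onS (du m); rewrite -finset.disjoints_subset bigcup_disjoint// => j _.
  by rewrite disjoint_sym dB// ltn_ord leqnn.
have E g : expect r (fun x => u m x * g (riesz (u ^~ x) m)) =
    expect r (u m) * expect r (fun x => g (riesz (u ^~ x) m)).
  rewrite mulrC -(expectM pr (dR g) dm) /expect.
  by apply: eq_bigr => x _; rewrite [u m x * _]mulrC.
congr pair; last by rewrite expectD (E fst).
rewrite -[X in _ - X](E snd) -mulN1r -expectZ -expectD /expect.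
by apply: eq_bigr => x _; rewrite mulN1r.
Qed.

(* The test function is the imaginary part of [\prod_j (1 + 'i y u_j)], where
   [u_j] is the sign test of block [j], centred half-way between its two means:
   by independence its expectations under [p] and [q] are opposite. *)
Lemma dist_blocks p q (B : nat -> {set K}) m (y : R) :
  is_prob p -> is_prob q ->
  (forall j k, (j < k < m)%N -> [disjoint B j & B k]) ->
  0 <= y -> y ^+ 2 * m%:R <= 1 ->
  y / 4 * \sum_(j < m) hdist p q (B j) <= 1 ->
  y / 4 * \sum_(j < m) hdist p q (B j) <= 5 / 3 * dist p q.
Proof.
move=> pp pq dB y0 ym Z1.
pose phi j := sgn_test (B j) p (hybrid (B j) p q).
pose mid j := (expect p (phi j) + expect q (phi j)) / 2.
pose u j x := y / 2 * (phi j x - mid j).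
have phidep j : depends_on (B j) (phi j) by exact: sgn_test_dep.
have udep j : depends_on (B j) (u j).
  by move=> x z e; rewrite /u (phidep j x z e).
have eu r j : is_prob r -> expect r (u j) = y / 2 * (expect r (phi j) - mid j).
  by move=> pr; rewrite /u expectZ expectD expect_cst.
have gap j : expect p (phi j) - expect q (phi j) = hdist p q (B j).
  rewrite /hdist -(@expect_sgn_test _ _ _ (B j))//.
    congr (_ - _); apply: (@expect_local _ _ _ (B j)) => //.
      exact: is_prob_hybrid.
    by move=> i iB; rewrite /hybrid iB.
  by move=> i /negPf iB; rewrite /hybrid iB.
have eup j : expect p (u j) = y / 4 * hdist p q (B j).
  by rewrite eu// -gap /mid; field.
have euq j : expect q (u j) = - (y / 4 * hdist p q (B j)).
  by rewrite eu// -gap /mid; field.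
(* A sign and the midpoint both lie in [-1, 1], so they differ by at most 2, which the factor y/2
   compensates. *)
have uy x j : u j x ^+ 2 <= y ^+ 2.
  have p1 : `|phi j x| <= 1 by exact: sgn_test_bound.
  have e1 : `|expect p (phi j)| <= 1.
    by apply: expect_bound => // z; exact: sgn_test_bound.
  have e2 : `|expect q (phi j)| <= 1.
    by apply: expect_bound => // z; exact: sgn_test_bound.
  rewrite ler_norml in p1; rewrite ler_norml in e1; rewrite ler_norml in e2.
  have : (phi j x - mid j) ^+ 2 <= 2 ^+ 2 by rewrite /mid; nra.
  by rewrite /u exprMn => h; have := sqr_ge0 y; nra.
(* The squared modulus is at most (1 + y^2)^m <= e^(y^2 m) <= e <= (5/3)^2. *)
have Mb x : `|(riesz (u ^~ x) m).2| <= 5 / 3.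
  have /le_trans/(_ (exprD1_le m (sqr_ge0 y))) := riesz_norm m (uy x).
  have eb : expR (y ^+ 2 * m%:R) <= 25 / 9.
    by apply: le_trans expR1_le; rewrite ler_expR.
  move=> /le_trans/(_ eb) h.
  have := sqr_ge0 (riesz (u ^~ x) m).1.
  by rewrite ler_norml; move=> ?; nra.
have := expect_dist p q Mb.
have /(congr1 snd) /= -> := expect_riesz pp udep dB.
have /(congr1 snd) /= -> := expect_riesz pq udep dB.
(* The product of the expectations under [q] is the conjugate of that under [p], so the test
   separates [p] and [q] by twice its imaginary part, which is at least the sum of the weights. *)
rewrite (_ : (fun j => expect q (u j)) = (fun j => - expect p (u j))); last first.
  by apply/funext => j; rewrite eup euq.
rewrite riesz_opp /= opprK.
have w0 j : 0 <= expect p (u j).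
  by rewrite eup mulr_ge0 ?divr_ge0// dist_ge0.
have ws : \sum_(j < m) expect p (u j) = y / 4 * \sum_(j < m) hdist p q (B j).
  by rewrite mulr_sumr; apply: eq_bigr.
have := riesz_im_ge w0; rewrite -ws in Z1 *.
by move=> /(_ _ Z1) h1 h2; lra.
Qed.

End RieszProducts.

(** * Averaging over permutations *)

Section Permutations.
Variable K : finType.
Implicit Types A B : {set K}.

(** The complements of [A] and of its image have the same size and are matched through their
    enumerations. *)
Lemma perm_extend A (f : K -> K) : {in A &, injective f} ->
  exists t : {perm K}, {in A, t =1 f}.
Proof.
move=> finj.
pose C := enum (~: A); pose D := enum (~: (f @: A)).
have sCD : size C = size D.
  by rewrite -!cardE; apply/eqP; rewrite -(eqn_add2l #|A|) cardsC
    -(card_in_imset finj) cardsC.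
pose g x := if x \in A then f x else nth x D (index x C).
have iC x : x \notin A -> (index x C < size D)%N.
  by move=> xA; rewrite -sCD index_mem mem_enum inE.
have gD x : x \notin A -> g x \notin f @: A.
  move=> xA; rewrite /g (negPf xA).
  by have := mem_nth x (iC x xA); rewrite mem_enum inE.
have ginj : injective g.
  move=> x y; case: (boolP (x \in A)) (boolP (y \in A)) => xA [] yA.
  - by rewrite /g xA yA; exact: finj.
  - move=> e; have := gD y yA; rewrite -e /g xA.
    by rewrite imset_f.
  - move=> e; have := gD x xA; rewrite e /g yA.
    by rewrite imset_f.
  rewrite /g (negPf xA) (negPf yA) (set_nth_default y) ?iC// => /eqP.
  rewrite nth_uniq ?iC ?enum_uniq// => /eqP e.
  have xC : x \in C by rewrite mem_enum inE.
  have yC : y \in C by rewrite mem_enum inE.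
  by rewrite -[LHS](nth_index x xC) e nth_index.
exists (perm ginj) => x xA; rewrite permE /g xA //.
Qed.

Lemma perm_onto A B : #|A| = #|B| -> exists t : {perm K}, t @: A = B.
Proof.
move=> cAB; pose f x := nth x (enum B) (index x (enum A)).
have iB x : x \in A -> (index x (enum A) < size (enum B))%N.
  by move=> xA; rewrite -cardE -cAB cardE index_mem mem_enum.
have finj : {in A &, injective f}.
  move=> x y xA yA; rewrite /f (set_nth_default y) ?iB// => /eqP.
  rewrite nth_uniq ?iB ?enum_uniq// => /eqP e.
  have xE : x \in enum A by rewrite mem_enum.
  have yE : y \in enum A by rewrite mem_enum.
  by rewrite -[LHS](nth_index x xE) e nth_index.
have [t tf] := perm_extend finj; exists t.
apply/eqP; rewrite eqEcard card_imset ?cAB ?leqnn ?andbT; last exact: perm_inj.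
apply/fintype.subsetP => _ /imsetP[x xA ->]; rewrite tf//.
by have := mem_nth x (iB x xA); rewrite mem_enum.
Qed.

End Permutations.

Lemma card_ord_range n a b : (b <= n)%N ->
  #|[set i : 'I_n | (a <= i < b)%N]| = (b - a)%N.
Proof.
move=> bn; rewrite -sum1dep_card -(big_mkord (fun i => (a <= i < b)%N) (fun=> 1%N)).
rewrite -(big_nat_widen 0 b n (fun i => a <= i)%N)//.
have [ab|ba] := leqP a b.
  rewrite -(big_nat_widenl a 0 b xpredT)//.
  by rewrite sum_nat_const_nat muln1.
rewrite (eqP (ltnW ba)) big_nat_cond big_pred0// => i.
by apply/negP => /andP[/andP[_ ib] ai]; move: (leq_trans ba ai); rewrite ltnNge ltnW.
Qed.

(** * Distance carried by a random block of coordinates *)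

Section PermutationAverage.
Variables (R : realType) (n : nat) (F : finType).
Implicit Types (p q : 'I_n -> F -> R) (A B L : {set 'I_n}).

Lemma hdist_local A p q p' q' : is_prob p -> is_prob q -> is_prob p' -> is_prob q' ->
  {in A, p =1 p'} -> {in A, q =1 q'} -> hdist p q A = hdist p' q' A.
Proof.
move=> pp pq pp' pq' ep eq; apply/eqP; rewrite eq_le; apply/andP; split;
  apply: (@dist_local _ _ _ A); try (by apply: is_prob_hybrid); try by [];
  move=> i iA; rewrite /hybrid ?iA ?(negPf iA)//.
- exact: eq.
- by rewrite ep.
- by rewrite eq.
Qed.

Lemma hdist0 p q : hdist p q finset.set0 = 0.
Proof.
rewrite /hdist /dist big1// => x _.
rewrite (_ : hybrid finset.set0 p q = p) ?subrr ?normr0//.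
by apply/funext => i; rewrite /hybrid inE.
Qed.

(** By [hdist_perm] this is n! times the mean of the distance carried by [t @: A], a uniformly
    random set of the size of [A]. *)
Definition perm_sum p q A := \sum_(t : {perm 'I_n}) hdist (p \o t) (q \o t) A.

Lemma perm_sum_imset p q (s : {perm 'I_n}) A :
  perm_sum p q (s @: A) = perm_sum p q A.
Proof.
rewrite /perm_sum [RHS](reindex_inj (mulgI s)); apply: eq_bigr => t _.
rewrite hdist_perm; congr hdist; apply/funext => i /=; by rewrite permM.
Qed.

Lemma perm_sum_card p q A B : #|A| = #|B| -> perm_sum p q A = perm_sum p q B.
Proof. by move=> /perm_onto[t <-]; rewrite perm_sum_imset. Qed.

Lemma perm_sum_le p q A : is_prob p -> is_prob q ->
  perm_sum p q A <= n`!%:R * dist p q.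
Proof.
move=> pp pq; rewrite /perm_sum.
have -> : n`!%:R * dist p q = \sum_(t : {perm 'I_n}) dist p q.
  by rewrite sumr_const mulr_natl -[in LHS](card_Sn n).
by apply: ler_sum => t _; rewrite -(dist_perm p q t); apply: hdist_le; apply: is_prob_comp.
Qed.

(** This trades the smallness condition of [dist_blocks] for one on [dist p q]: if the left side
    exceeded 1, shrinking [y] to 4/S would make it equal to 1, and [dist_blocks] would give a
    distance of at least 3/5. *)
Lemma dist_blocks_sqrt p q (B : nat -> {set 'I_n}) m (y : R) :
  is_prob p -> is_prob q ->
  (forall j k, (j < k < m)%N -> [disjoint B j & B k]) ->
  0 <= y -> y ^+ 2 * m%:R <= 1 -> dist p q < 3 / 5 ->
  y / 4 * \sum_(j < m) hdist p q (B j) <= 5 / 3 * dist p q.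
Proof.
move=> pp pq dB y0 ym d35.
set S := \sum_(j < m) _.
have [Z1|Z1] := leP (y / 4 * S) 1; first exact: dist_blocks.
have S0 : 0 <= S by apply: sumr_ge0 => j _; exact: dist_ge0.
have Sp : 0 < S by rewrite lt_neqAle S0 andbT; apply/eqP => e;
  move: Z1; rewrite -e mulr0 ltr10.
have yS : 4 / S <= y by rewrite ler_pdivrMr//; lra.
have yS0 : 0 <= 4 / S by rewrite divr_ge0.
have y2 : (4 / S) ^+ 2 * m%:R <= 1.
  by apply: le_trans ym; rewrite ler_wpM2r// lerXn2r.
have e1 : 4 / S / 4 * S = 1 by field; rewrite gt_eqF.
have := dist_blocks pp pq dB yS0 y2; rewrite -/S e1 => /(_ (lexx _)) ?; lra.
Qed.

(** With x the proportion of positions in [L], the natural bound is of order sqrt(2x). It is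
    linearised as sqrt(2x) <= x/b + b/2, so that it can be averaged over [L]. *)
Lemma perm_sum_sqrt p q L (b : R) : is_prob p -> is_prob q -> 0 < b ->
  dist p q < 3 / 5 ->
  perm_sum p q L <=
    n`!%:R * dist p q * (20 / 3 * (#|L|%:R / n%:R / b + b / 2)).
Proof.
move=> pp pq b0 d35.
have D0 := dist_ge0 p q.
set x := #|L|%:R / n%:R.
have x0 : 0 <= x by rewrite divr_ge0.
have [/eqP|s0] := posnP #|L|.
  rewrite cards_eq0 => /eqP ->; rewrite /perm_sum big1 => [|t _]; last exact: hdist0.
  by rewrite mulr_ge0// mulr_ge0// addr_ge0 ?divr_ge0// ltW.
have sn : (#|L| <= n)%N by rewrite -[leqRHS]card_ord max_card.
have n0 : (0 < n)%N by exact: leq_trans sn.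
(* There is room for [m] disjoint intervals of the size of [L], and all of them have the same
   [perm_sum] as [L]. *)
set m := (n %/ #|L|)%N.
have m0 : (0 < m)%N by rewrite divn_gt0.
have mR : 0 < m%:R :> R by rewrite ltr0n.
pose B j := [set i : 'I_n | (j * #|L| <= i < j.+1 * #|L|)%N].
have cB (j : 'I_m) : #|B j| = #|L|.
  rewrite card_ord_range ?mulSn ?addnK//.
  by rewrite -mulSn (leq_trans _ (leq_trunc_div n #|L|))// leq_mul2r ltn_ord orbT.
have dB j k : (j < k < m)%N -> [disjoint B j & B k].
  move=> /andP[jk km]; rewrite -finset.setI_eq0; apply/eqP/finset.setP => i; rewrite !inE.
  apply/negbTE/negP => /andP[/andP[_ h1] /andP[h2 _]].
  have := leq_ltn_trans h2 h1; rewrite ltn_mul2r s0 /= ltnS leqNgt.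
  by rewrite jk.
pose y := Num.sqrt (m%:R^-1 : R).
have y0 : 0 <= y by exact: sqrtr_ge0.
have y2 : y ^+ 2 = m%:R^-1 by rewrite sqr_sqrtr ?invr_ge0 ?ler0n.
have y2m : y ^+ 2 * m%:R = 1 by rewrite y2 mulVf// gt_eqF.
have key : y / 4 * (m%:R * perm_sum p q L) <= n`!%:R * (5 / 3 * dist p q).
  have -> : m%:R * perm_sum p q L = \sum_(j < m) perm_sum p q (B j).
    under eq_bigr => j _ do rewrite (perm_sum_card p q (cB j)).
    by rewrite sumr_const card_ord mulr_natl.
  rewrite /perm_sum exchange_big mulr_sumr.
  have -> : n`!%:R * (5 / 3 * dist p q) = \sum_(t : {perm 'I_n}) (5 / 3 * dist p q).
    by rewrite sumr_const mulr_natl -[in LHS](card_Sn n).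
  apply: ler_sum => t _; rewrite -(dist_perm p q t).
  apply: dist_blocks_sqrt => //; rewrite ?dist_perm//; try exact: is_prob_comp.
  by rewrite y2m.
have yx : y ^+ 2 <= 2 * x.
  (* The remainder of the division is below [#|L|], hence at most [m * #|L|]. *)
  have n2 : (n <= 2 * (m * #|L|))%N.
    rewrite {1}(divn_eq n #|L|) -/m mul2n -addnn leq_add2l.
    by rewrite (leq_trans (ltnW (ltn_pmod n s0)))// leq_pmull.
  rewrite y2 -[leLHS]mul1r ler_pdivrMr// /x.
  have -> : 2 * (#|L|%:R / n%:R) * m%:R = 2 * (m%:R * #|L|%:R) / n%:R :> R by ring.
  by rewrite ler_pdivlMr ?ltr0n// mul1r -!natrM ler_nat.
have yb : y <= x / b + b / 2.
  rewrite -(ler_pM2r b0) mulrDl divfK ?gt_eqF//.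
  have := sqr_ge0 (y - b); nra.
have : perm_sum p q L <= n`!%:R * dist p q * (20 / 3 * y).
  (* Multiplying [key] by [y] makes [m] disappear, since y^2 m = 1. *)
  have : y * (y / 4 * (m%:R * perm_sum p q L)) <= y * (n`!%:R * (5 / 3 * dist p q)).
    by rewrite ler_wpM2l.
  have -> : y * (y / 4 * (m%:R * perm_sum p q L)) =
    (y ^+ 2 * m%:R) * perm_sum p q L / 4 by field.
  by rewrite y2m; lra.
move/le_trans; apply; rewrite ler_wpM2l ?mulr_ge0//.
by rewrite ler_wpM2l.
Qed.

End PermutationAverage.

(** * Finite alphabets *)

Section Layers.
Variable n : nat.
Implicit Type g : {ffun 'I_n -> 'I_n}.

Definition earlier g (j : 'I_n) : {set 'I_n} := [set k : 'I_n | (k < j)%N && (g k == g j)].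

Definition layer g k : {set 'I_n} := [set j | #|earlier g j| == k].

(** If i < j take the same value, the positions counted for i, together with i itself, are counted
    for j, so the layer index increases strictly. *)
Lemma layer_inj g k : {in layer g k &, injective g}.
Proof.
have H (i j : 'I_n) : (i < j)%N -> g i = g j -> (#|earlier g i| < #|earlier g j|)%N.
  move=> ij gij; apply: proper_card; apply/properP; split.
    apply/fintype.subsetP => l; rewrite !inE => /andP[li /eqP ->].
    by rewrite gij eqxx (ltn_trans li).
  by exists i; rewrite !inE ?ij ?gij ?eqxx// ltnn.
move=> i j; rewrite !inE => /eqP ci /eqP cj gij; apply/val_inj.
case: (ltngtP i j) => // h; first by have := H _ _ h gij; rewrite ci cj ltnn.
by have := H _ _ h (esym gij); rewrite ci cj ltnn.
Qed.

Lemma layer_disjoint g j k : (j < k)%N -> [disjoint layer g j & layer g k].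
Proof.
move=> jk; rewrite -finset.setI_eq0; apply/eqP/finset.setP => i; rewrite !inE.
by apply/negbTE/negP => /andP[/eqP -> /eqP e]; rewrite e ltnn in jk.
Qed.

Lemma bigcup_layer g : \bigcup_(k < n) layer g k = [set: 'I_n].
Proof.
apply/finset.setP => j; rewrite inE; apply/finset.bigcupP.
have cj : (#|earlier g j| < n)%N.
  rewrite -[ltnRHS]card_ord -cardsT; apply: proper_card.
  by apply/properP; split => //; exists j; rewrite !inE// ltnn.
by exists (Ordinal cj); rewrite ?inE.
Qed.

Lemma layer_perm (t : {perm 'I_n}) g k : layer [ffun i => t (g i)] k = layer g k.
Proof.
apply/finset.setP => j; rewrite !inE; congr (_ == _); apply: eq_card => i.
by rewrite !inE !ffunE (inj_eq perm_inj).
Qed.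

Lemma sum_layer (R : pzSemiRingType) g (a : nat -> R) :
  \sum_(k < n) a k * #|layer g k|%:R = \sum_j a #|earlier g j|.
Proof.
have E (k : 'I_n) : a k * #|layer g k|%:R =
    \sum_j if #|earlier g j| == k then a #|earlier g j| else 0.
  rewrite -big_mkcond /= mulr_natr -sumr_const.
  apply: eq_big => [j|j]; first by rewrite inE.
  by rewrite inE => /eqP ->.
under eq_bigr do rewrite E.
rewrite exchange_big; apply: eq_bigr => j _ /=.
have : j \in \bigcup_(k < n) layer g k by rewrite bigcup_layer inE.
move=> /finset.bigcupP[k _]; rewrite inE => /eqP jk.
rewrite (bigD1 k)//= jk eqxx big1 ?addr0// => l lk.
by case: eqP => // /val_inj kl; rewrite kl eqxx in lk.
Qed.

End Layers.

(** * Exponential moment of the layer index *)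

Section ExponentialMoment.
Variables (R : realType) (n : nat).

(** Counting all positions other than [j] where the value of [g] at [j] recurs, not only the earlier
    ones, gives n (n + 4)^(n-1) <= n^n e^4, and e^4 <= (25/9)^4 < 60. *)
Lemma sum_pow_earlier (j : 'I_n) :
  \sum_(g : {ffun 'I_n -> 'I_n}) 5 ^+ #|earlier g j| <= n%:R ^+ n * 60 :> R.
Proof.
have n0 : (0 < n)%N by exact: leq_ltn_trans (ltn_ord j).
(* For a fixed [v] the product over [k] vanishes unless [g j] is [v], and is then 5 to the number of
   other positions with that value. Sums of such products over all maps factorise. *)
pose w (v k f : 'I_n) : R :=
  if k == j then (f == v)%:R else if f == v then 5 else 1.
have w0 v k f : 0 <= w v k f by rewrite /w; case: ifP => _; [|case: ifP].
apply: (@le_trans _ _ (\sum_(v : 'I_n) \prod_(k : 'I_n) \sum_f w v k f)).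
  have -> : \sum_(v : 'I_n) \prod_(k : 'I_n) \sum_f w v k f =
      \sum_(g : {ffun 'I_n -> 'I_n}) \sum_v \prod_k w v k (g k).
    by rewrite exchange_big; apply: eq_bigr => v _; rewrite bigA_distr_bigA.
  apply: ler_sum => g _; rewrite (bigD1 (g j))//=.
  apply: (@le_trans _ _ (\prod_k w (g j) k (g k))); last first.
    by rewrite lerDl sumr_ge0// => v _; apply: prodr_ge0 => k _.
  rewrite -prodr_const big_mkcond; apply: ler_prod => k _.
  rewrite inE /w; case: (eqVneq k j) => [->|kj]; first by rewrite ltnn eqxx ler01 lexx.
  by case: eqP => _; case: (k < j)%N => /=; rewrite ?ler0n//; apply/andP; split => //; lra.
have wj v : \sum_f w v j f = 1.
  rewrite (bigD1 v)//= /w eqxx eqxx big1 ?addr0// => f fv.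
  by rewrite (negPf fv).
have wk v k : k != j -> \sum_f w v k f = n%:R + 4.
  move=> kj; rewrite (bigD1 v)//= /w (negPf kj) eqxx.
  rewrite (eq_bigr (fun=> 1)) => [|f fv]; last by rewrite (negPf fv).
  have : \sum_(f : 'I_n) 1 = n%:R :> R by rewrite sumr_const card_ord.
  by rewrite (bigD1 v)//=; lra.
have E v : \prod_(k : 'I_n) \sum_f w v k f = (n%:R + 4) ^+ n.-1.
  rewrite (bigD1 j)//= wj mul1r (eq_bigr (fun=> n%:R + 4)); last by move=> k; exact: wk.
  rewrite prodr_const; congr (_ ^+ _).
  by have := cardC1 j; rewrite card_ord => <-; apply: eq_card => k; rewrite !inE.
under eq_bigr do rewrite E.
rewrite sumr_const card_ord -[_ ^+ _ *+ n]mulr_natl.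
have nR : 0 < n%:R :> R by rewrite ltr0n.
apply: (@le_trans _ _ ((n%:R + 4) ^+ n)).
  have -> : (n%:R + 4) ^+ n = (n%:R + 4) * (n%:R + 4) ^+ n.-1 :> R.
    by rewrite -exprS prednK.
  by rewrite ler_wpM2r ?exprn_ge0 ?addr_ge0// lerDl.
have -> : n%:R + 4 = n%:R * (1 + 4 / n%:R) :> R by field; rewrite gt_eqF.
rewrite exprMn ler_wpM2l ?exprn_ge0//.
apply: (le_trans (exprD1_le _ _)); first by rewrite divr_ge0.
rewrite divfK ?gt_eqF// -[4]mulr1 expRM_natl.
apply: (@le_trans _ _ ((25 / 9) ^+ 4)); last by lra.
by rewrite lerXn2r ?nnegrE ?expR_ge0 ?divr_ge0//; exact: expR1_le.
Qed.

End ExponentialMoment.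

(** * The inequality over a finite alphabet *)

Section FiniteHomogenization.
Variables (R : realType) (n : nat) (F : finType).
Implicit Types (p q : 'I_n -> F -> R) (g : {ffun 'I_n -> 'I_n}).
Hypothesis n0 : (0 < n)%N.

(** A family constant in its index, so that [prodw] of it is the n-th power of the mean
    distribution. *)
Definition average p (_ : 'I_n) f := n%:R^-1 * \sum_i p i f.

Lemma prodw_average p x :
  prodw (average p) x = n%:R ^- n * \sum_(g : {ffun 'I_n -> 'I_n}) prodw (p \o g) x.
Proof.
rewrite /prodw /average big_split /= prodr_const card_ord exprVn; congr (_ * _).
exact: (bigA_distr_bigA (fun i k => p k (x i))).
Qed.

Lemma is_prob_average p : is_prob p -> is_prob (average p).
Proof.
case=> p0 p1; split=> [i f|i]; rewrite /average.
  by rewrite mulr_ge0 ?invr_ge0 ?ler0n ?sumr_ge0.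
rewrite -mulr_sumr exchange_big /= (eq_bigr (fun=> 1)) => [|k _]; last exact: p1.
by rewrite sumr_const card_ord mulVf// pnatr_eq0 -lt0n.
Qed.

Lemma dist_average_le p q :
  dist (average p) (average q) <=
  n%:R ^- n * \sum_(g : {ffun 'I_n -> 'I_n}) dist (p \o g) (q \o g).
Proof.
rewrite [X in _ <= _ * X]exchange_big mulr_sumr; apply: ler_sum => x _.
rewrite !prodw_average -mulrBr normrM ger0_norm ?invr_ge0 ?exprn_ge0//.
rewrite ler_wpM2l ?invr_ge0 ?exprn_ge0// -sumrB; exact: ler_norm_sum.
Qed.

Lemma dist_comp_layers p q g : is_prob p -> is_prob q ->
  dist (p \o g) (q \o g) <= \sum_(k < n) hdist (p \o g) (q \o g) (layer g k).
Proof.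
move=> pp pq.
have := @dist_layers _ _ _ (p \o g) (q \o g) (layer g) n (is_prob_comp _ pp)
  (is_prob_comp _ pq) (@layer_disjoint n g).
rewrite bigcup_layer; congr (dist _ _ <= _); apply/funext => i.
by rewrite /hybrid inE.
Qed.

(* The indices are first permuted at random: on its own layer the index map is
   injective, hence agrees there with a permutation. *)
Lemma sum_hdist_layer p q k : is_prob p -> is_prob q ->
  n`!%:R * \sum_(g : {ffun 'I_n -> 'I_n}) hdist (p \o g) (q \o g) (layer g k) =
  \sum_(g : {ffun 'I_n -> 'I_n}) perm_sum p q (layer g k).
Proof.
move=> pp pq.
pose G g := hdist (p \o g) (q \o g) (layer g k).
have E (t : {perm 'I_n}) : \sum_(g : {ffun 'I_n -> 'I_n}) G g =
    \sum_(g : {ffun 'I_n -> 'I_n}) hdist (p \o t \o g) (q \o t \o g) (layer g k).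
  have inj : injective (fun g => [ffun i => t (g i)] : {ffun 'I_n -> 'I_n}).
    move=> g h /ffunP e; apply/ffunP => i; have := e i; rewrite !ffunE.
    exact: perm_inj.
  rewrite (reindex_inj inj); apply: eq_bigr => g _.
  by rewrite /G layer_perm; congr hdist; apply/funext => i /=; rewrite ffunE.
have -> : n`!%:R * \sum_(g : {ffun 'I_n -> 'I_n}) G g =
  \sum_(t : {perm 'I_n}) \sum_(g : {ffun 'I_n -> 'I_n}) G g.
  by rewrite sumr_const mulr_natl -[in LHS](card_Sn n).
rewrite (eq_bigr _ (fun t _ => E t)) exchange_big; apply: eq_bigr => g _.
have [s sg] := perm_extend (@layer_inj n g k).
rewrite /perm_sum [RHS](reindex_inj (mulgI s)); apply: eq_bigr => t _.
apply: hdist_local; try (by do ?apply: is_prob_comp).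
  by move=> i iL /=; rewrite permM sg.
by move=> i iL /=; rewrite permM sg.
Qed.

Lemma sum_pow_le (r : R) m k : 0 <= r < 1 ->
  \sum_(i < m | (k <= i)%N) r ^+ i <= r ^+ k / (1 - r).
Proof.
move=> /andP[r0 r1].
have rr : 0 < 1 - r by rewrite subr_gt0.
rewrite ler_pdivlMr//.
have [mk|/ltnW km] := leqP m k.
  rewrite big_pred0 ?mul0r ?exprn_ge0// => i.
  by apply/negbTE; rewrite -ltnNge (leq_trans (ltn_ord i)).
suff : \sum_(i < m | (k <= i)%N) r ^+ i * (1 - r) = r ^+ k - r ^+ m.
  by rewrite mulr_suml => ->; rewrite gerBl exprn_ge0.
rewrite -(big_mkord (fun i => (k <= i)%N) (fun i => r ^+ i * (1 - r))).
rewrite -(big_nat_widenl k 0 m xpredT)//.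
under eq_bigr do rewrite mulrBr mulr1 -exprSr.
rewrite (@telescope_sumr_eq _ _ _ (fun i => - r ^+ i))//.
  by rewrite opprK addrC.
by move=> i _; rewrite opprK addrC.
Qed.

Theorem dist_average p q : is_prob p -> is_prob q ->
  149 / 1000 * dist (average p) (average q) <= dist p q.
Proof.
move=> pp pq; set D := dist p q.
have D0 : 0 <= D by exact: dist_ge0.
(* Since [dist] never exceeds 2, the claim is trivial for D >= 2 * 0.149. Otherwise D is small
   enough for [perm_sum_sqrt]. *)
have [D1|D1] := leP (298 / 1000) D.
  have := dist_le2 (is_prob_average pp) (is_prob_average pq); lra.
have D35 : D < 3 / 5 by lra.
have nR : 0 < n%:R :> R by rewrite ltr0n.
(* [b k] weighs the AM-GM bound of the square root of the size of layer [k];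
   540 nearly minimizes the sum over the layers. *)
have [be be0 [beE1 beE2]] :
    exists2 be : R, 0 < be & be / 2 = 270 /\ 20 / 3 / be = 1 / 81.
  exists 540; first by rewrite ltr0n.
  by split; field.
pose b k : R := be * 5^-1 ^+ k.
have b0 k : 0 < b k.
  apply: mulr_gt0; first exact: be0.
  by apply: exprn_gt0; rewrite invr_gt0 ltr0n.
pose x g k : R := #|layer g k|%:R / n%:R.
(* In units of D: the trivial bound on the first five layers, then the linearised square root at a
   scale [b k] that decreases geometrically. *)
pose bound g k : R :=
  if (k < 5)%N then 1 else 20 / 3 * (x g k / b k + b k / 2).
have fact0 : 0 < n`!%:R :> R by rewrite ltr0n fact_gt0.
have layer_le k :
    \sum_(g : {ffun 'I_n -> 'I_n}) hdist (p \o g) (q \o g) (layer g k) <=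
    D * \sum_(g : {ffun 'I_n -> 'I_n}) bound g k.
  rewrite -(ler_pM2l fact0) sum_hdist_layer// mulrA mulr_sumr; apply: ler_sum => g _.
  rewrite /bound; case: ifP => _; first by rewrite mulr1; exact: perm_sum_le.
  exact: perm_sum_sqrt.
have bound_le g : \sum_(k < n) bound g k <=
    572 / 100 + 1 / 81 / n%:R * \sum_j 5 ^+ #|earlier g j|.
  rewrite -(sum_layer g (fun k => 5 ^+ k)).
  (* The 5 counts the first layers; the rest, 0.72, is the geometric tail of the terms [b k / 2]
     from layer 5 on. *)
  have -> : 572 / 100 = 5 + 20 / 3 * 270 * (5^-1 ^+ 5 / (1 - 5^-1)) :> R.
    have -> : 1 - 5^-1 = 4 / 5 :> R by field.
    have -> : 5^-1 ^+ 5 = 1 / 3125 :> R by field.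
    by field.
  apply: (@le_trans _ _ (\sum_(k < n | (k < 5)%N) 1 +
     20 / 3 * 270 * (\sum_(k < n | (5 <= k)%N) 5^-1 ^+ k) +
     1 / 81 / n%:R * \sum_(k < n) 5 ^+ k * #|layer g k|%:R)).
    rewrite !mulr_sumr [X in X + _ + _]big_mkcond [X in _ + X + _]big_mkcond /=.
    rewrite -!big_split /=; apply: ler_sum => k _.
    have xb : x g k / b k = be^-1 / n%:R * (5 ^+ k * #|layer g k|%:R).
      by rewrite /b /x invfM exprVn invrK; ring.
    rewrite /bound; case: (ltnP k 5) => _ /=.
      by rewrite addr0 lerDl !mulr_ge0 ?invr_ge0 ?exprn_ge0 ?ler0n.
    rewrite add0r xb /b -beE1 -beE2 le_eqVlt; apply/orP; left; apply/eqP.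
    by field; rewrite !gt_eqF.
  rewrite lerD2r lerD//.
    have -> : \sum_(k < n | (k < 5)%N) 1 =
        (\sum_(k < n | (k < 5)%N) 1)%N%:R :> R.
      by rewrite natr_sum.
    rewrite ler_nat -(big_mkord (fun k => (k < 5)%N) (fun=> 1%N)).
    have [n5|n5] := leqP n 5.
      rewrite big_mkcond (leq_trans (leq_sum _ (fun k _ => leq_b1 (k < 5)%N)))//.
      by rewrite sum_nat_const_nat muln1 subn0.
    rewrite -(big_nat_widen 0 5 n xpredT _ (ltnW n5)).
    by rewrite sum_nat_const_nat muln1.
  apply: ler_wpM2l; first by lra.
  by apply: sum_pow_le; apply/andP; split; lra.
have N0 : 0 < n%:R ^+ n :> R by rewrite exprn_gt0.
(* On average over [g] the last term of [bound_le] is at most 60/81 < 0.745, and 5.72 + 0.745 =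
   6.465. *)
have total : \sum_(g : {ffun 'I_n -> 'I_n}) \sum_(k < n) bound g k <=
    n%:R ^+ n * (6465 / 1000).
  apply: (le_trans (ler_sum _ (fun g _ => bound_le g))).
  rewrite big_split /= sumr_const card_ffun !card_ord -mulr_sumr exchange_big /=.
  have : \sum_(j < n) \sum_(g : {ffun 'I_n -> 'I_n}) 5 ^+ #|earlier g j| <=
      n%:R * (n%:R ^+ n * 60) :> R.
    apply: (@le_trans _ _ (\sum_(j < n) (n%:R ^+ n * 60))).
      by apply: ler_sum => j _; exact: sum_pow_earlier.
    by rewrite sumr_const card_ord [leRHS]mulr_natl.
  move=> h; rewrite -[_ *+ (n ^ n)]mulr_natr natrX.
  have : 1 / 81 / n%:R *
        \sum_(j < n) \sum_(g : {ffun 'I_n -> 'I_n}) 5 ^+ #|earlier g j| <=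
      1 / 81 / n%:R * (n%:R * (n%:R ^+ n * 60)) :> R.
    by rewrite ler_wpM2l// divr_ge0.
  rewrite [X in _ <= X -> _](_ : _ = 1 / 81 * (n%:R ^+ n * 60)); last first.
    by field; rewrite gt_eqF.
  by lra.
have : n%:R ^+ n * dist (average p) (average q) <= D * (n%:R ^+ n * (6465 / 1000)).
  apply: (@le_trans _ _ (\sum_(g : {ffun 'I_n -> 'I_n}) dist (p \o g) (q \o g))).
    rewrite mulrC -ler_pdivlMr// mulrC; exact: dist_average_le.
  apply: (@le_trans _ _ (D * \sum_(g : {ffun 'I_n -> 'I_n}) \sum_(k < n) bound g k)); last first.
    by rewrite ler_wpM2l.
  apply: (le_trans (ler_sum _ (fun g _ => dist_comp_layers g pp pq))).
  rewrite exchange_big /= [X in D * X]exchange_big mulr_sumr /=.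
  by apply: ler_sum => k _; exact: layer_le.
rewrite mulrCA ler_pM2l// => h.
(* What remains is that 0.149 * 6.465 is less than 1. *)
have := dist_ge0 (average p) (average q); lra.
Qed.

End FiniteHomogenization.

Local Open Scope classical_set_scope.
Local Open Scope ring_scope.

(** * Product measures and approximation by cylinders *)

Section ProductProbability.
Variables (d : measure_display) (T : measurableType d) (R : realType).

(** Normalising a measure of total mass 1 does not change it, and the result is packaged as a
    probability; the Dirac mass is only the default value that normalisation requires. *)
Lemma measure_probability d' (U : measurableType d') (mu : {measure set U -> \bar R}) :
  mu setT = 1%E -> exists nu : probability U R, mu = nu :> (set U -> \bar R).
Proof.
move=> mu1; pose P0 : probability U R := dirac point.
have E : mnormalize mu P0 = mu.
  by apply/funext => A; rewrite /mnormalize mu1 onee_eq0/= invr1 mule1.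
by exists (mnormalize mu P0); rewrite -[LHS]E.
Qed.

Lemma measurable_cons_tuple n :
  measurable_fun setT (fun u : T * n.-tuple T => cons_tuple u.1 u.2).
Proof. by apply: measurable_cons. Qed.

Definition box n (A : 'I_n -> set T) : set (n.-tuple T) :=
  [set t | forall i, A i (tnth t i)].

Lemma measurable_box n (A : 'I_n -> set T) : (forall i, measurable (A i)) ->
  measurable (box A).
Proof.
move=> mA; rewrite (_ : box A = \bigcap_(i in setT) ((@tnth n T)^~ i @^-1` A i)).
  apply: fin_bigcap_measurable => // i _; rewrite -[X in measurable X]setTI.
  exact: measurable_tnth.
by apply/seteqP; split => [t At i _|t At i]; [exact: At|exact: (At i)].
Qed.

(** By induction: the product is the image of a binary product measure, under which a box becomes
    the rectangle of its first side and the box of the others. *)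
Lemma prod_meas_probability n (P : 'I_n -> probability T R) :
  exists2 mu : probability (n.-tuple T) R,
    prod_meas (fun i => P i) = mu :> (set _ -> \bar R) &
    forall A : 'I_n -> set T, (forall i, measurable (A i)) ->
      mu (box A) = (\prod_(i < n) fine (P i (A i)))%:E.
Proof.
elim: n P => [|n IH] P.
  exists (dirac [tuple]) => [|A mA].
    by apply/funext => A; rewrite /= /dirac.
  by rewrite big_ord0 /= /dirac indicE mem_set// => -[].
have [mu /= muE mubox] := IH (fun i => P (lift ord0 i)).
have [nu nuE] : exists nu : probability (T * n.-tuple T)%type R,
    product_measure1 (P ord0) mu = nu :> (set _ -> \bar R).
  apply: measure_probability.
  rewrite -setXTT; transitivity (P ord0 setT * mu setT)%E.
    exact: product_measure1E.
  by rewrite !probability_setT mule1.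
pose f := @measurable_cons_tuple n.
pose X : {mfun (T * n.-tuple T)%type >-> n.+1.-tuple T} := mfun_Sub (mem_set f).
exists (distribution nu X).
  by apply/funext => A; rewrite /= muE nuE.
move=> A mA.
rewrite big_ord_recl EFinM fineK ?fin_num_measure// -mubox; last by move=> i.
rewrite -product_measure1E//; last exact: measurable_box.
rewrite nuE /distribution /pushforward; congr (nu _).
apply/seteqP; split => -[x t] /= => [xt|[Ax At] i].
  split; first exact: (xt ord0).
  by move=> i; have := xt (lift ord0 i); rewrite tnthS.
by case: (unliftP ord0 i) => [j|] ->; rewrite ?tnthS.
Qed.

Lemma avg_meas_probability n (P : 'I_n -> probability T R) : (0 < n)%N ->
  exists2 M : probability T R, avg_meas (fun i => P i) = M :> (set T -> \bar R) &
    forall A, measurable A -> fine (M A) = n%:R^-1 * \sum_(i < n) fine (P i A).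
Proof.
case: n P => // n P _.
(* [msum] takes a sequence, so the family is extended to all natural numbers by [inord]. *)
pose m (k : nat) : {measure set T -> \bar R} := P (inord k).
have c0 : 0 <= n.+1%:R^-1 :> R by rewrite invr_ge0.
have E : mscale (NngNum c0) (msum m n.+1) = avg_meas (fun i => P i) :> (set T -> \bar R).
  apply/funext => A; rewrite /mscale /avg_meas /msum /=; congr (_ * _)%E.
  by apply: eq_bigr => i _; rewrite /m inord_val.
have avgE A : measurable A -> avg_meas (fun i => P i) A =
   (n.+1%:R^-1 * \sum_(i < n.+1) fine (P i A))%:E.
  move=> mA; rewrite /avg_meas EFinM; congr (_ * _)%E.
  by rewrite -sumEFin; apply: eq_bigr => i _; rewrite fineK ?fin_num_measure.
have [M ME] : exists M : probability T R,
    mscale (NngNum c0) (msum m n.+1) = M :> (set T -> \bar R).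
  apply: measure_probability.
  transitivity (avg_meas (fun i => P i) setT); first by rewrite -E.
  rewrite avgE//; congr (_%:E).
  rewrite (eq_bigr (fun=> 1)) => [|i _]; last by rewrite probability_setT.
  by rewrite sumr_const card_ord mulVf// pnatr_eq0.
have aM : avg_meas (fun i => P i) = M by rewrite -E.
by exists M => // A mA; rewrite -aM avgE.
Qed.

End ProductProbability.

(** * Approximation of events by finitely coded ones *)

Section Cylinders.
Variables (d : measure_display) (T : measurableType d) (R : realType) (n : nat).

Definition coding (F : finType) (D : T -> F) (t : n.-tuple T) : {ffun 'I_n -> F} :=
  [ffun i => D (tnth t i)].

Definition fin_measurable (F : finType) (D : T -> F) :=
  forall f, measurable (D @^-1` [set f]).

(** One finite code serves all coordinates, so that such an event is an event over the finite
    alphabet [F]. *)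
Definition cylinder (C : set (n.-tuple T)) :=
  exists (F : finType) (D : T -> F) (X : {set {ffun 'I_n -> F}}),
    fin_measurable D /\ C = coding D @^-1` [set` X].

Lemma cylinder_bigcup (F : finType) (D : T -> F) (X : {set {ffun 'I_n -> F}}) :
  coding D @^-1` [set` X] =
  \bigcup_(x in [set` enum X]) box (fun i => D @^-1` [set x i]).
Proof.
apply/seteqP; split => [t /= tX|t [x /= xX tx]].
  exists (coding D t); first by rewrite /= mem_enum.
  by move=> i /=; rewrite ffunE.
rewrite (_ : coding D t = x); first by rewrite mem_enum in xX.
by apply/ffunP => i; rewrite ffunE; exact: tx.
Qed.

Lemma measurable_cylinder C : cylinder C -> measurable C.
Proof.
move=> [F [D [X [mD ->]]]]; rewrite cylinder_bigcup.
by apply: fin_bigcup_measurable => // x _; exact: measurable_box.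
Qed.

(** A cylinder is a finite disjoint union of boxes of cells, so its measure is a sum of finite
    product weights. *)
Lemma prod_measure_cylinder (P : 'I_n -> probability T R)
    (mu : probability (n.-tuple T) R) (F : finType) (D : T -> F)
    (X : {set {ffun 'I_n -> F}}) :
  (forall A : 'I_n -> set T, (forall i, measurable (A i)) ->
      mu (box A) = (\prod_(i < n) fine (P i (A i)))%:E) ->
  fin_measurable D ->
  mu (coding D @^-1` [set` X]) =
    (\sum_(x in X) \prod_i fine (P i (D @^-1` [set x i])))%:E.
Proof.
move=> mubox mD; rewrite cylinder_bigcup measure_fin_bigcup//.
- rewrite -fsbig_seq ?enum_uniq// big_enum -sumEFin.
  by apply: eq_bigr => x _; exact: (mubox (fun i => D @^-1` [set x i])).
- move=> x y _ _ [t [tx ty]]; apply/ffunP => i.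
  by have := tx i; have := ty i => /= <- <-.
- by move=> x _; exact: measurable_box.
Qed.

Lemma cylinderC C : cylinder C -> cylinder (~` C).
Proof.
move=> [F [D [X [mD ->]]]]; exists F, D, (finset.setC X); split => //.
by apply/seteqP; split => t /=; rewrite finset.in_setC => /negP.
Qed.

(** The pair of the two codes refines both, and both events are read off from it. *)
Lemma cylinderU B C : cylinder B -> cylinder C -> cylinder (B `|` C).
Proof.
move=> [F1 [D1 [X1 [mD1 ->]]]] [F2 [D2 [X2 [mD2 ->]]]].
exists (F1 * F2)%type, (fun t => (D1 t, D2 t)),
  [set x : {ffun 'I_n -> F1 * F2} | ([ffun i => (x i).1] \in X1)
      || ([ffun i => (x i).2] \in X2)]%SET; split.
  move=> [f1 f2]; rewrite (_ : _ @^-1` _ = (D1 @^-1` [set f1]) `&` (D2 @^-1` [set f2])).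
    exact: measurableI.
  by apply/seteqP; split => t /= [-> ->].
have E1 t : [ffun i => ((coding (fun t => (D1 t, D2 t)) t) i).1] = coding D1 t.
  by apply/ffunP => i; rewrite !ffunE.
have E2 t : [ffun i => ((coding (fun t => (D1 t, D2 t)) t) i).2] = coding D2 t.
  by apply/ffunP => i; rewrite !ffunE.
by apply/seteqP; split => t /=; rewrite inE E1 E2 => /orP.
Qed.

Lemma cylinder_set0 : cylinder set0.
Proof.
exists unit, (fun=> tt), finset.set0; split.
  move=> [] ; rewrite (_ : _ @^-1` _ = setT)//; by apply/seteqP.
by apply/seteqP; split => t //=; rewrite inE.
Qed.

Lemma cylinder_tnth (i : 'I_n) (A : set T) : measurable A ->
  cylinder ((fun t => tnth t i) @^-1` A).
Proof.
move=> mA; exists bool, (fun x => `[< A x >]), [set x : {ffun 'I_n -> bool} | x i]%SET.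
split => [b|].
  case: b.
    rewrite (_ : _ @^-1` _ = A)//.
    by apply/seteqP; split => x /= => [/asboolP|Ax]; [|apply/asboolP].
  rewrite (_ : _ @^-1` _ = ~` A); first exact: measurableC.
  apply/seteqP; split => x /= => [/asboolPn|Ax]; first by [].
  by apply/asboolPn.
by apply/seteqP; split => t /=; rewrite inE ffunE => /asboolP.
Qed.

Variable mu : {measure set (n.-tuple T) -> \bar R}.
Hypothesis mu_fin : (mu setT < +oo)%E.

Definition approximable (E : set (n.-tuple T)) :=
  measurable E /\ forall e : R, 0 < e ->
    exists2 C, cylinder C & (mu (E `+` C) <= e%:E)%E.

Lemma measurable_setY (A B : set (n.-tuple T)) :
  measurable A -> measurable B -> measurable (A `+` B).
Proof. by move=> mA mB; apply: measurableU; exact: measurableD. Qed.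

Lemma approximable_cylinder C : cylinder C -> approximable C.
Proof.
move=> cC; split; first exact: measurable_cylinder.
by move=> e e0; exists C => //; rewrite setYK measure0 lee_fin ltW.
Qed.

Lemma approximableC E : approximable E -> approximable (~` E).
Proof.
move=> [mE aE]; split; first exact: measurableC.
move=> e /aE[C cC EC]; exists (~` C); first exact: cylinderC.
rewrite (_ : ~` E `+` ~` C = E `+` C)//.
by rewrite /setY !setDE !setCK setIC [X in _ `|` X]setIC setUC.
Qed.

Lemma approximableU A B : approximable A -> approximable B -> approximable (A `|` B).
Proof.
move=> [mA aA] [mB aB]; split; first exact: measurableU.
move=> e e0; have e2 : 0 < e / 2 by rewrite divr_gt0.
have [C cC AC] := aA _ e2; have [D cD BD] := aB _ e2.
have mC := measurable_cylinder cC; have mD := measurable_cylinder cD.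
exists (C `|` D); first exact: cylinderU.
apply: (@le_trans _ _ (mu ((A `+` C) `|` (B `+` D)))).
  apply: le_measure; rewrite ?inE; do ?[apply: measurable_setY|apply: measurableU] => //.
  by move=> t; rewrite /setY /=; tauto.
apply: (le_trans (measureU2 _ (measurable_setY mA mC) (measurable_setY mB mD))).
by rewrite [e]splitr EFinD; apply: leeD.
Qed.

Lemma approximable_bigsetU (A : (set (n.-tuple T))^nat) k :
  (forall j, approximable (A j)) -> approximable (\big[setU/set0]_(j < k) A j).
Proof.
move=> aA; elim: k => [|k IH].
  by rewrite big_ord0; apply: approximable_cylinder; exact: cylinder_set0.
by rewrite big_ord_recr /=; exact: approximableU.
Qed.

(** The parts of the union missed by the finite unions decrease to the empty set, so by finiteness
    of [mu] their measures tend to 0; a finite union missing at most e/2 is then approximated up to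
    e/2. *)
Lemma approximable_bigcup (A : (set (n.-tuple T))^nat) :
  (forall j, approximable (A j)) -> approximable (\bigcup_j A j).
Proof.
move=> aA; set U := \bigcup_j A j.
have mA j : measurable (A j) by have [] := aA j.
have mU : measurable U by exact: bigcup_measurable.
split => // e e0; have e2 : 0 < e / 2 by rewrite divr_gt0.
pose V k := \big[setU/set0]_(j < k) A j.
have mV k : measurable (V k) by have [] := approximable_bigsetU k aA.
pose W k := U `\` V k.
have mW k : measurable (W k) by exact: measurableD.
have W0 : \bigcap_k W k = set0.
  apply/seteqP; split => // t Wt; have [[j _ Ajt] _] := Wt 0%N I.
  have [_] := Wt j.+1 I; apply; rewrite /V -bigcup_mkord.
  by exists j => //=.
have Wni : nonincreasing_seq W.
  move=> j k jk; apply/subsetPset; apply: setDS; rewrite /V -!bigcup_mkord.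
  by move=> t [l /= lj Alt]; exists l => //=; exact: leq_trans jk.
have Wcvg : mu \o W @ \oo --> 0%E.
  have := @nonincreasing_cvg_mu _ _ _ mu W; rewrite W0 measure0; apply => //.
  by rewrite (le_lt_trans _ mu_fin)// le_measure ?inE.
have [k Wk] : exists k, (mu (W k) <= (e / 2)%:E)%E.
  have /fine_cvgP[Wfin /cvgrPdist_le/(_ _ e2) We] := Wcvg.
  near \oo => k; exists k.
  have fk : mu (W k) \is a fin_num by near: k.
  rewrite -(fineK fk) lee_fin (le_trans (ler_norm _))//.
  by rewrite -normrN -[- _]add0r; near: k.
have [_ /(_ _ e2)[C cC VC]] := approximable_bigsetU k aA.
have mC := measurable_cylinder cC.
exists C => //.
apply: (@le_trans _ _ (mu (W k `|` (V k `+` C)))).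
  apply: le_measure; rewrite ?inE; do ?[apply: measurable_setY|apply: measurableU] => //.
  have VU : V k `<=` U by rewrite /V -bigcup_mkord => t [j _ Ajt]; exists j.
  move=> t; rewrite /setY /W /=; have := VU t; have := pselect (V k t); tauto.
apply: (le_trans (measureU2 _ (mW k) (measurable_setY (mV k) mC))).
by rewrite [e]splitr EFinD; apply: leeD.
Unshelve. all: by end_near. Qed.

(** Approximable events form a sigma-algebra containing the coordinate events, which generate the
    product sigma-algebra. *)
Lemma measurable_approximable E : measurable E -> approximable E.
Proof.
apply: smallest_sub.
  split.
  - by apply: approximable_cylinder; exact: cylinder_set0.
  - by move=> A aA; rewrite setTD; exact: approximableC.
  - exact: approximable_bigcup.
rewrite -bigcup_seq => A [i _ [B mB <-]]; rewrite setTI.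
by apply: approximable_cylinder; exact: cylinder_tnth.
Qed.

End Cylinders.

(** * The theorem *)

Section PositivePart.
Variables (R : realDomainType) (X : finType).
Implicit Type h : X -> R.

(** The positive and the negative part have the same mass, hence each half of the total. *)
Lemma sum_gt0_part h : \sum_x h x = 0 ->
  2 * (\sum_(x | 0 < h x) h x) = \sum_x `|h x|.
Proof.
move=> h0; rewrite (bigID (fun x => 0 < h x)) /= in h0.
rewrite [RHS](bigID (fun x => 0 < h x)) /=.
rewrite [X in _ = X + _](eq_bigr h) => [|x hx]; last by rewrite gtr0_norm.
rewrite [X in _ = _ + X](eq_bigr (fun x => - h x)) => [|x]; last first.
  by rewrite -leNgt => hx; rewrite ler0_norm.
rewrite sumrN; lra.
Qed.

Lemma norm_sum_le (A : {pred X}) h : \sum_x h x = 0 ->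
  2 * `|\sum_(x in A) h x| <= \sum_x `|h x|.
Proof.
(* A partial sum is at most the sum of all positive terms; applied to [- h], this also bounds
   negative partial sums. *)
have le (g : X -> R) : \sum_x g x = 0 -> 2 * (\sum_(x in A) g x) <= \sum_x `|g x|.
  move=> g0; rewrite -(sum_gt0_part g0) ler_wpM2l//.
  rewrite big_mkcond [leRHS]big_mkcond /=; apply: ler_sum => x _.
  by case: (x \in A); case: (ltP 0 (g x)) => // /ltW.
move=> h0; have [s0|s0] := leP 0 (\sum_(x in A) h x).
  by rewrite ger0_norm// le.
rewrite ltr0_norm// -sumrN (le_trans (le (fun x => - h x) _)) ?sumrN ?h0 ?oppr0//.
by apply: ler_sum => x _; rewrite normrN.
Qed.

End PositivePart.

Lemma sum_prodwB (R : realType) (K F : finType) (r s : K -> F -> R) :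
  is_prob r -> is_prob s -> \sum_x (prodw r x - prodw s x) = 0.
Proof. by move=> [_ r1] [_ s1]; rewrite sumrB !sum_prodw ?subrr. Qed.

(** * From finite alphabets to arbitrary measurable spaces *)

Section Homogenization.
Variables (d : measure_display) (T : measurableType d) (R : realType) (n : nat).
Hypothesis n0 : (0 < n)%N.

Definition cell (F : finType) (D : T -> F) (P : 'I_n -> probability T R)
  (i : 'I_n) (f : F) : R := fine (P i (D @^-1` [set f])).

Lemma is_prob_cell (F : finType) (D : T -> F) (P : 'I_n -> probability T R) :
  fin_measurable D -> is_prob (cell D P).
Proof.
move=> mD; split=> [i f|i]; first by rewrite /cell fine_ge0.
apply: EFin_inj; rewrite -sumEFin.
under eq_bigr => f _ do rewrite /cell fineK ?fin_num_measure//.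
rewrite -(probability_setT (P i)).
rewrite (_ : setT = \bigcup_(f in [set` enum F]) D @^-1` [set f]); last first.
  by apply/seteqP; split => // x _; exists (D x) => //=; rewrite mem_enum.
rewrite measure_fin_bigcup//.
- by rewrite -fsbig_seq ?enum_uniq// big_enum.
- by move=> f g _ _ [x [/= <- <-]].
Qed.

Lemma norm_measure_diff (mu : probability (n.-tuple T) R) (A B : set (n.-tuple T)) :
  measurable A -> measurable B ->
  `|fine (mu A) - fine (mu B)| <= fine (mu (A `+` B)).
Proof.
move=> mA mB; have mAB := measurable_setY mA mB.
have le A' B' : measurable A' -> measurable B' ->
    fine (mu A') <= fine (mu (A' `+` B')) + fine (mu B').
  move=> mA' mB'; have mAB' := measurable_setY mA' mB'.
  rewrite -lee_fin EFinD !fineK ?fin_num_measure//.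
  apply: le_trans (measureU2 _ mAB' mB'); apply: le_measure; rewrite ?inE//.
    exact: measurableU.
  by move=> t; rewrite /setY /=; have := pselect (B' t); tauto.
have := le _ _ mA mB; have := le _ _ mB mA.
by rewrite [B `+` A]setYC ler_norml => ? ?; apply/andP; split; lra.
Qed.

Lemma TV_homogenization (P Q : 'I_n -> probability T R) :
  ((149 / 1000)%:E * TV (@pow_meas d T R n (@avg_meas d T R n (fun i => P i)))
                     (@pow_meas d T R n (@avg_meas d T R n (fun i => Q i)))
   <= TV (@prod_meas d T R n (fun i => P i)) (@prod_meas d T R n (fun i => Q i)))%E.
Proof.
have [muP muPE boxP] := prod_meas_probability P.
have [muQ muQE boxQ] := prod_meas_probability Q.
have [MP MPE avgP] := avg_meas_probability P n0.
have [MQ MQE avgQ] := avg_meas_probability Q n0.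
have [nuP nuPE nboxP] := prod_meas_probability (fun _ : 'I_n => MP).
have [nuQ nuQE nboxQ] := prod_meas_probability (fun _ : 'I_n => MQ).
rewrite /pow_meas MPE MQE nuPE nuQE muPE muQE /TV /TV_on.
rewrite -ereal_sup_pZl; last by rewrite divr_gt0 ?ltr0n.
apply: ge_ereal_sup => _ [_ [E mE <-] <-].
(* Approximation with respect to the sum of the measures gives one cylinder close to [E] under
   both. *)
pose mu := measure_add nuP nuQ.
have mu_fin : (mu setT < +oo)%E.
  have -> : mu setT = (nuP setT + nuQ setT)%E by exact: measure_addE.
  by rewrite !probability_setT ltry.
apply/lee_addgt0Pr => e e0.
have [_ /(_ _ e0)[C cC EC]] := measurable_approximable mu_fin mE.
have mC := measurable_cylinder cC.
have mEC := measurable_setY mE mC.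
have fEC : fine (nuP (E `+` C)) + fine (nuQ (E `+` C)) <= e.
  by rewrite -lee_fin EFinD !fineK ?fin_num_measure// -measure_addE.
have [F [D [X [mD CE]]]] := cC.
pose p := cell D P; pose q := cell D Q.
have pp : is_prob p by exact: is_prob_cell.
have pq : is_prob q by exact: is_prob_cell.
have avE (M : probability T R) (P' : 'I_n -> probability T R) :
    (forall A, measurable A -> fine (M A) = n%:R^-1 * \sum_(i < n) fine (P' i A)) ->
    cell D (fun=> M) = average (cell D P').
  by move=> h; apply/funext => i; apply/funext => f; rewrite /cell h.
have sumE (M : 'I_n -> probability T R) (nu : probability (n.-tuple T) R)
    (Y : {set {ffun 'I_n -> F}}) :
    (forall A : 'I_n -> set T, (forall i, measurable (A i)) ->
      nu (box A) = (\prod_(i < n) fine (M i (A i)))%:E) ->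
    nu (coding D @^-1` [set` Y]) = (\sum_(x in Y) prodw (cell D M) x)%:E.
  by move=> h; exact: (prod_measure_cylinder Y h mD).
have key : 149 / 1000 * `|fine (nuP C) - fine (nuQ C)| <= dist p q / 2.
  rewrite CE (sumE _ _ _ nboxP) (sumE _ _ _ nboxQ) /= (avE _ _ avgP) (avE _ _ avgQ).
  rewrite -sumrB.
  have h := norm_sum_le (mem X)
    (sum_prodwB (is_prob_average n0 pp) (is_prob_average n0 pq)).
  have := dist_average n0 pp pq; rewrite /dist /= in h *; lra.
(* Pulled back to the product space, the words more likely under [p] than under [q] form an event
   attaining half of [dist p q]. *)
pose Y := [set x | 0 < prodw p x - prodw q x]%SET.
pose CY : set (n.-tuple T) := coding D @^-1` [set` Y].
have mCY : measurable CY by apply: measurable_cylinder; exists F, D, Y.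
have CYE : dist p q / 2 <= `|fine (muP CY) - fine (muQ CY)|.
  rewrite (sumE _ _ _ boxP) (sumE _ _ _ boxQ) /= -sumrB.
  apply: le_trans (ler_norm _).
  have := sum_gt0_part (sum_prodwB pp pq); rewrite -/(dist p q) => <-.
  by under [leRHS]eq_bigl do rewrite inE; rewrite mulrC mulKf.
have abse_fine (a b : probability (n.-tuple T) R) A : measurable A ->
    (`|a A - b A|)%E = `|fine (a A) - fine (b A)|%:E.
  by move=> mA; rewrite -{1}(fineK (fin_num_measure a A mA));
  rewrite -{1}(fineK (fin_num_measure b A mA)).
have tv : ((dist p q / 2)%:E <=
    ereal_sup [set (`|muP A - muQ A|)%E | A in measurable])%E.
  apply: le_ereal_sup_tmp; exists (`|muP CY - muQ CY|)%E; first by exists CY.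
  by rewrite abse_fine// lee_fin.
apply: (@le_trans _ _ ((dist p q / 2)%:E + e%:E)%E); last by rewrite leeD2r.
(* Replacing [E] by [C] changes the difference of the two measures by at most [e], and the constant
   in front is below 1. *)
rewrite abse_fine// -EFinM -EFinD lee_fin.
have := norm_measure_diff nuP mE mC; have := norm_measure_diff nuQ mE mC.
have := ler_normD (fine (nuP E) - fine (nuP C) - (fine (nuQ E) - fine (nuQ C)))
  (fine (nuP C) - fine (nuQ C)).
have := ler_normB (fine (nuP E) - fine (nuP C)) (fine (nuQ E) - fine (nuQ C)).
have -> : fine (nuP E) - fine (nuP C) - (fine (nuQ E) - fine (nuQ C)) +
  (fine (nuP C) - fine (nuQ C)) = fine (nuP E) - fine (nuQ E) by ring.
lra.
Qed.

End Homogenization.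

(** * Reduction to the multinomial distributions *)

Section Multinomial.
Variables (d : measure_display) (T : finMeasurableType d) (R : realType) (n : nat).
Hypothesis mT : forall A : set T, measurable A.

Definition tuple_weight (M : set T -> \bar R) (s : n.-tuple T) : R :=
  \prod_(i < n) fine (M [set tnth s i]).

Lemma tuple_weight_counts (M : set T -> \bar R) (s t : n.-tuple T) :
  counts s = counts t -> tuple_weight M s = tuple_weight M t.
Proof.
move=> /ffunP st.
have E (u : n.-tuple T) : tuple_weight M u = \prod_(x <- u) fine (M [set x]).
  by rewrite big_tuple.
rewrite !E; apply: perm_big; apply/allP => x _ /=; apply/eqP.
by have := st x; rewrite !ffunE.
Qed.

Lemma multE (M : set T -> \bar R) (E : set {ffun T -> nat}) :
  mult n M E = (\sum_(s : n.-tuple T | counts s \in E) tuple_weight M s)%:E.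
Proof.
rewrite /mult [in RHS]big_mkcond; congr (_%:E); apply: eq_bigr => s _.
by rewrite indicE; case: (counts s \in E); rewrite ?mul1r ?mul0r.
Qed.

Definition fun_tuple (x : {ffun 'I_n -> T}) : n.-tuple T := [tuple x i | i < n].

Lemma coding_fun_tuple x : coding id (fun_tuple x) = x.
Proof. by apply/ffunP => i; rewrite ffunE tnth_mktuple. Qed.

Lemma fun_tuple_coding (s : n.-tuple T) : fun_tuple (coding id s) = s.
Proof. by apply: eq_from_tnth => i; rewrite tnth_mktuple ffunE. Qed.

(** With the identity as code, every event over a finite space is a cylinder. *)
Lemma set_tuple_coding (E : set (n.-tuple T)) :
  E = coding id @^-1` [set` [set x | fun_tuple x \in E]%SET].
Proof.
by apply/seteqP; split => s /=; rewrite inE fun_tuple_coding in_setE.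
Qed.

Lemma fin_measurable_id : fin_measurable (id : T -> T).
Proof. by move=> f; exact: mT. Qed.

Lemma measurable_tuple_set (E : set (n.-tuple T)) : measurable E.
Proof.
rewrite (set_tuple_coding E); apply: measurable_cylinder.
by exists T, id, [set x | fun_tuple x \in E]%SET; split => //; exact: fin_measurable_id.
Qed.

Lemma finite_pow_meas (M : probability T R) (E : set (n.-tuple T)) :
  @pow_meas d T R n M E = (\sum_(s : n.-tuple T | s \in E) tuple_weight M s)%:E.
Proof.
have [nu nuE nubox] := prod_meas_probability (fun _ : 'I_n => M).
rewrite /pow_meas nuE [in LHS](set_tuple_coding E).
have := prod_measure_cylinder [set x | fun_tuple x \in E]%SET nubox fin_measurable_id.
move=> ->; congr (_%:E).
rewrite [RHS](reindex fun_tuple) /=; last first.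
  by exists (coding id) => x _; [exact: coding_fun_tuple|exact: fun_tuple_coding].
apply: eq_big => [x|x _]; first by rewrite inE.
by apply: eq_bigr => i _; rewrite tnth_mktuple.
Qed.

Lemma sum_tuple_weight (M : probability T R) : \sum_s tuple_weight M s = 1.
Proof.
have [nu nuE _] := prod_meas_probability (fun _ : 'I_n => M).
apply: EFin_inj; rewrite -(probability_setT nu) -nuE.
rewrite [RHS](finite_pow_meas M setT); congr (_%:E).
by apply: eq_bigl => s; rewrite in_setT.
Qed.

Lemma TV_pow_meas_mult (M N : probability T R) :
  TV (@pow_meas d T R n M) (@pow_meas d T R n N) =
  TV_on [set: set {ffun T -> nat}] (mult n M) (mult n N).
Proof.
pose h s := tuple_weight M s - tuple_weight N s.
have h0 : \sum_s h s = 0 by rewrite sumrB !sum_tuple_weight subrr.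
have powE E : (`|@pow_meas d T R n M E - @pow_meas d T R n N E|)%E =
    `|\sum_(s | s \in E) h s|%:E.
  by rewrite !finite_pow_meas -EFinB sumrB.
have mulE E : (`|mult n M E - mult n N E|)%E =
    `|\sum_(s : n.-tuple T | counts s \in E) h s|%:E.
  by rewrite !multE -EFinB sumrB.
rewrite /TV /TV_on; apply/eqP; rewrite eq_le; apply/andP; split.
  apply: ge_ereal_sup => _ [E _ <-]; rewrite powE.
  (* Tuple weights depend only on the counts, so the preimage of [pos] is exactly the set where [h]
     is positive, and this set attains the supremum. *)
  pose pos : set {ffun T -> nat} := [set counts s | s in [set s : n.-tuple T | 0 < h s]].
  apply: le_ereal_sup_tmp; exists (`|mult n M pos - mult n N pos|)%E.
    by exists pos.
  rewrite mulE lee_fin [in leRHS](eq_bigl (fun s => 0 < h s)); last first.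
    move=> s; apply/idP/idP => [|hs]; last first.
      by rewrite in_setE; exists s.
    rewrite in_setE => -[t /= ht /tuple_weight_counts ts].
    by rewrite /h -!ts.
  rewrite [leRHS]ger0_norm ?sumr_ge0// => [|s /ltW//].
  rewrite -(ler_pM2l (ltr0n _ 2)) (sum_gt0_part h0).
  exact: (norm_sum_le [pred s | s \in E] h0).
apply: ge_ereal_sup => _ [E _ <-].
(* Conversely, an event on counts has the same probabilities as its preimage under [counts]. *)
apply: le_ereal_sup_tmp; exists (`|@pow_meas d T R n M (@counts T n @^-1` E) -
    @pow_meas d T R n N (@counts T n @^-1` E)|)%E.
  by apply: imageP; exact: measurable_tuple_set.
by rewrite powE mulE.
Qed.

End Multinomial.

Unset Implicit Arguments.

Theorem theorem4 (R : realType) :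
  (exists c : R, (1489%:R / 10000%:R < c) /\
     forall (d : measure_display) (T : measurableType d) (n : nat)
            (P Q : 'I_n -> probability T R),
       (0 < n)%N ->
       (TV (@prod_meas d T R n (fun i => P i)) (@prod_meas d T R n (fun i => Q i))
        >= c%:E * TV (@pow_meas d T R n (@avg_meas d T R n (fun i => P i)))
                     (@pow_meas d T R n (@avg_meas d T R n (fun i => Q i))))%E)
  /\
  (forall (d : measure_display) (T : finMeasurableType d),
     (forall A : set T, measurable A) ->
     forall (n : nat) (P Q : 'I_n -> probability T R),
       (0 < n)%N ->
       TV (@pow_meas d T R n (@avg_meas d T R n (fun i => P i)))
          (@pow_meas d T R n (@avg_meas d T R n (fun i => Q i)))
       = TV_on [set: set {ffun T -> nat}]
           (@mult d T R n (@avg_meas d T R n (fun i => P i)))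
           (@mult d T R n (@avg_meas d T R n (fun i => Q i)))).
Proof.
split.
  exists (149 / 1000); split; first by lra.
  by move=> d T n P Q n0; exact: TV_homogenization.
move=> d T mT n P Q n0.
have [MP MPE _] := avg_meas_probability P n0.
have [MQ MQE _] := avg_meas_probability Q n0.
by rewrite MPE MQE; exact: TV_pow_meas_mult.
Qed.
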